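(* Let $\tau$ be a pattern, regarded as a subword (consecutive) pattern, whose largest letter is $r-1$, and let $\tau'=\tau\text{-}r$. Then for all $k\ge r-1$, $$W_{\tau'}(x;k)=\frac{1}{(1-(r-1)x)\prod_{j=r-1}^{k-1}\bigl(1-xW_{\tau}(x;j)\bigr)}.$$
   Context: For $k\ge1$ let $[k]=\{1,\dots,k\}$; a $k$-ary word of length $n$ is an element of $[k]^n$ ($[0]^n$ is empty for $n\ge1$, and the empty word is the unique word of length $0$). A pattern is a word in $[p]^m$ in which each letter of $[p]$ occurs. Two words are order-isomorphic if replacing the $i$-th smallest distinct letter by $i$ yields the same word. A word $w$ contains the subword pattern $\tau$ of length $m$ if some $m$ consecutive letters of $w$ are order-isomorphic to $\tau$. For $\tau$ of length $m$, the vincular pattern $\tau\text{-}r$ occurs in $w=w_1\cdots w_n$ if there are indices $p$ and $q\ge p+m$ with $w_p\cdots w_{p+m-1}w_q$ order-isomorphic to the word $\tau r$. $a_\sigma(n,k)$ denotes the number of words in $[k]^n$ avoiding $\sigma$, and $W_\sigma(x;k)=\sum_{n\ge0}a_\sigma(n,k)x^n$ (formal power series). An empty product equals $1$. *)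

(* Defs.v *)
From HB Require Import structures.
From mathcomp Require Import all_boot all_order all_algebra.
From mathcomp Require Import boolp.

Set Implicit Arguments.
Unset Strict Implicit.
Unset Printing Implicit Defensive.

Import GRing.Theory.
Local Open Scope ring_scope.

(** * Formal power series *)

Record fps (R : Type) := FPS { fps_coef : nat -> R }.

HB.instance Definition _ (R : Type) := gen_eqMixin (fps R).
HB.instance Definition _ (R : Type) := gen_choiceMixin (fps R).

Lemma fpsP (R : Type) (f g : fps R) : fps_coef f =1 fps_coef g -> f = g.
Proof. by case: f g => [f] [g] /= /funext ->. Qed.

Section FpsZmodule.
Variable R : zmodType.
Implicit Types f g h : fps R.

Definition fps0 : fps R := FPS (fun _ => 0).
Definition fps_opp f : fps R := FPS (fun n => - fps_coef f n).
Definition fps_add f g : fps R := FPS (fun n => fps_coef f n + fps_coef g n).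

Fact fps_addA : associative fps_add.
Proof. by move=> f g h; apply: fpsP => n /=; rewrite addrA. Qed.
Fact fps_addC : commutative fps_add.
Proof. by move=> f g; apply: fpsP => n /=; rewrite addrC. Qed.
Fact fps_add0 : left_id fps0 fps_add.
Proof. by move=> f; apply: fpsP => n /=; rewrite add0r. Qed.
Fact fps_addN : left_inverse fps0 fps_opp fps_add.
Proof. by move=> f; apply: fpsP => n /=; rewrite addNr. Qed.

HB.instance Definition _ :=
  GRing.isZmodule.Build (fps R) fps_addA fps_addC fps_add0 fps_addN.

End FpsZmodule.

Section FpsRing.
Variable R : comNzRingType.
Implicit Types f g h : fps R.

Definition fps1 : fps R := FPS (fun n => (n == 0%N)%:R).
Definition fpsX : fps R := FPS (fun n => (n == 1%N)%:R).
Definition fps_mul f g : fps R :=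
  FPS (fun n => \sum_(i < n.+1) fps_coef f i * fps_coef g (n - i)%N).

Let trunc n f : {poly R} := \poly_(i < n.+1) fps_coef f i.

Let coef_trunc n f i : (i <= n)%N -> (trunc n f)`_i = fps_coef f i.
Proof. by move=> le_in; rewrite coef_poly ltnS le_in. Qed.

Let coef_mul_trunc n f g i : (i <= n)%N ->
  fps_coef (fps_mul f g) i = (trunc n f * trunc n g)`_i.
Proof.
move=> le_in; rewrite coefM /=; apply: eq_bigr => j _.
have le_ji : (j <= i)%N by rewrite -ltnS.
by rewrite !coef_trunc // ?(leq_trans le_ji) // (leq_trans (leq_subr _ _)).
Qed.

Fact fps_mulC : commutative fps_mul.
Proof.
by move=> f g; apply: fpsP => n; rewrite !(@coef_mul_trunc n) // mulrC.
Qed.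

Fact fps_mulA : associative fps_mul.
Proof.
move=> f g h; apply: fpsP => n.
transitivity (trunc n f * (trunc n g * trunc n h))`_n.
  rewrite [LHS]/= coefM; apply: eq_bigr => i _.
  have le_in : (i <= n)%N by rewrite -ltnS.
  by rewrite coef_trunc // -coef_mul_trunc // leq_subr.
rewrite mulrA [RHS]/= coefM; apply: eq_bigr => i _.
have le_in : (i <= n)%N by rewrite -ltnS.
by rewrite coef_trunc ?leq_subr // -coef_mul_trunc.
Qed.

Fact fps_mul1 : left_id fps1 fps_mul.
Proof.
move=> f; apply: fpsP => n /=.
by rewrite big_ord_recl /= mul1r subn0 big1 ?addr0 // => i _; rewrite mul0r.
Qed.

Fact fps_mulD : left_distributive fps_mul +%R.
Proof.
move=> f g h; apply: fpsP => n /=.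
by rewrite -big_split; apply: eq_bigr => i _; rewrite mulrDl.
Qed.

Fact fps1_neq0 : fps1 != 0.
Proof.
by apply/eqP => /(congr1 (fun f => fps_coef f 0%N)) /eqP; rewrite /= oner_eq0.
Qed.

HB.instance Definition _ := GRing.Zmodule_isComNzRing.Build (fps R)
  fps_mulA fps_mulC fps_mul1 fps_mulD fps1_neq0.

End FpsRing.

Arguments fpsX {R}.

Section FpsUnitRing.
Variable R : comUnitRingType.
Implicit Types f g h : fps R.

Definition fps_unit : pred (fps R) := fun f => fps_coef f 0 \is a GRing.unit.

(* The first n coefficients of 1 / f, obtained by solving (1 / f) * f = 1. *)
Fixpoint fps_inv_seq f n : seq R :=
  if n is m.+1 then
    let s := fps_inv_seq f m in
    rcons s (((m == 0%N)%:R - \sum_(i < m) s`_i * fps_coef f (m - i))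
             / fps_coef f 0)
  else [::].

(* As everywhere in the MathComp hierarchy, non-units are their own inverse. *)
Definition fps_inv f : fps R :=
  if fps_unit f then FPS (fun n => (fps_inv_seq f n.+1)`_n) else f.

Let size_fps_inv_seq f n : size (fps_inv_seq f n) = n.
Proof. by elim: n => //= n IHn; rewrite size_rcons IHn. Qed.

Let nth_fps_inv_seq f n i : (i < n)%N ->
  (fps_inv_seq f n)`_i = (fps_inv_seq f i.+1)`_i.
Proof.
elim: n => // n IHn; rewrite ltnS leq_eqVlt => /predU1P[-> // | lt_in].
by rewrite [LHS]nth_rcons size_fps_inv_seq lt_in IHn.
Qed.

Fact fps_mulVr : {in fps_unit, left_inverse 1 fps_inv *%R}.
Proof.
move=> f; rewrite unfold_in /fps_unit => Uf; apply: fpsP => n.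
rewrite /fps_inv /fps_unit Uf /= big_ord_recr /= subnn.
rewrite nth_rcons size_fps_inv_seq ltnn eqxx divrK // addrC.
under [X in _ - X]eq_bigr do rewrite nth_fps_inv_seq //.
by rewrite subrK.
Qed.

Fact fps_unitP f g : g * f = 1 -> fps_unit f.
Proof.
move=> /(congr1 (fun f => fps_coef f 0%N)); rewrite /= big_ord1 /= => gf1.
by apply/unitrPr; exists (fps_coef g 0); rewrite mulrC.
Qed.

Fact fps_inv_out : {in [predC fps_unit], fps_inv =1 id}.
Proof. by move=> f /negbTE Uf; rewrite /fps_inv [fps_unit f]Uf. Qed.

HB.instance Definition _ := GRing.ComNzRing_hasMulInverse.Build (fps R)
  fps_mulVr fps_unitP fps_inv_out.

End FpsUnitRing.

(** * Words and patterns *)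

(* Words are sequences of positive integers.  The elements of [k]^n are the
   sequences [word_of w] for w : n.-tuple 'I_k, whose letters are shifted from
   {0, ..., k - 1} to {1, ..., k}. *)
Definition word_of (k : nat) (w : seq 'I_k) : seq nat :=
  [seq i.+1 | i : 'I_k <- w].

Definition is_pattern (tau : seq nat) : Prop :=
  exists p : nat, tau =i iota 1 p.

Definition largest_letter (tau : seq nat) (s : nat) : bool :=
  (s \in tau) && all (fun a => (a <= s)%N) tau.

(* Replaces the i-th smallest distinct letter of w by i. *)
Definition standardize (w : seq nat) : seq nat :=
  [seq (index a (sort leq (undup w))).+1 | a <- w].

Definition order_iso (u v : seq nat) : bool := standardize u == standardize v.

(* Positions are numbered from 0. *)
Definition factor (w : seq nat) (p m : nat) : seq nat := take m (drop p w).

Definition contains_subword (tau w : seq nat) : bool :=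
  [exists p : 'I_(size w).+1,
     (p + size tau <= size w)%N && order_iso (factor w p (size tau)) tau].

(* Occurrence of the vincular pattern tau-r. *)
Definition contains_vincular (tau : seq nat) (r : nat) (w : seq nat) : bool :=
  [exists p : 'I_(size w), exists q : 'I_(size w),
     (p + size tau <= q)%N &&
     order_iso (rcons (factor w p (size tau)) (nth 0%N w q)) (rcons tau r)].

(* A pattern sigma enters only through the predicate "w contains sigma". *)
Definition num_avoiding (contains : pred (seq nat)) (n k : nat) : nat :=
  #|[set w : n.-tuple 'I_k | ~~ contains (word_of w)]|.

Definition W (contains : pred (seq nat)) (k : nat) : fps int :=
  FPS (fun n => (num_avoiding contains n k)%:R).

(* Main.v *)
Require Import Defs.
From mathcomp Require Import all_boot all_order all_algebra.
From mathcomp Require Import zify.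

(** Cut a word over [k+1] at its first occurrence of the largest letter, as
    [u (k+1) v] with [u] over [k].  The part of an occurrence of [tau-r] that
    matches [tau] never uses the letter [k+1], because a larger letter follows
    it; hence it lies in [u] or in [v].  Conversely, an occurrence of [tau] in
    [u] is completed by the letter [k+1].  So the word avoids [tau-r] iff [u]
    avoids [tau] and [v] avoids [tau-r], that is,
    [W_(tau-r)(k+1) = W_(tau-r)(k) + x W_tau(k) W_(tau-r)(k+1)].  The recursion starts at
    [k = r-1], where [tau-r] cannot occur for lack of letters. *)

Import GRing.Theory.

(** * Order isomorphism with an appended maximum *)

Lemma ltn_index_sort_undup (w : seq nat) (a b : nat) :
  a \in w -> b \in w ->
  (index a (sort leq (undup w)) < index b (sort leq (undup w))) = (a < b).
Proof.
set s := sort leq (undup w) => aw bw.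
have ms x : (x \in s) = (x \in w) by rewrite mem_sort mem_undup.
have ss : sorted leq s by apply: sort_sorted leq_total _.
have le_of_lt x y : x \in w -> y \in w -> index x s < index y s -> x <= y.
  by move=> xw yw; apply: sorted_ltn_index; rewrite ?ms //; apply: leq_trans.
apply/idP/idP => [lt_ab|].
  rewrite ltn_neqAle le_of_lt // andbT.
  by apply: contraTneq lt_ab => ->; rewrite ltnn.
apply: contraLR; rewrite -!leqNgt leq_eqVlt => /predU1P[eq_ba|]; last exact: le_of_lt.
by rewrite -(nth_index 0 (_ : a \in s)) ?ms // -eq_ba nth_index ?ms.
Qed.

(** Standardizing is injective on letters, so the number of distinct letters is an invariant of
    order isomorphism. This fixes the rank of an appended maximum and later drives a pigeonhole
    argument. *)
Lemma size_undup_standardize (w : seq nat) :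
  size (undup (standardize w)) = size (undup w).
Proof.
rewrite /standardize; set f := fun a => _.
rewrite -(size_map f (undup w)); apply: perm_size; apply: uniq_perm.
- exact: undup_uniq.
- rewrite map_inj_in_uniq ?undup_uniq // => a b; rewrite !mem_undup => aw bw [eq_ab].
  rewrite -(nth_index 0 (_ : a \in sort leq (undup w))) ?mem_sort ?mem_undup //.
  by rewrite eq_ab nth_index // mem_sort mem_undup.
- by move=> b; rewrite mem_undup; apply: eq_mem_map => a; rewrite mem_undup.
Qed.

(** The new maximum is sorted last, so the ranks of the letters of [u] do not change. *)
Lemma standardize_rcons_max (u : seq nat) (c : nat) :
  all (fun a => a < c) u ->
  standardize (rcons u c) = rcons (standardize u) (size (undup u)).+1.
Proof.
move=> /allP lt_uc.
have c_u : c \notin u by apply/negP => /lt_uc; rewrite ltnn.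
have sortE : sort leq (undup (rcons u c)) = sort leq (undup u) ++ [:: c].
  apply: (sorted_eq leq_trans anti_leq); first exact: sort_sorted leq_total _.
    rewrite sorted_pairwise; last exact: leq_trans.
    rewrite pairwise_cat /= -sorted_pairwise; last exact: leq_trans.
    rewrite (sort_sorted leq_total) !andbT; apply/allP => a.
    by rewrite mem_sort mem_undup /= andbT => /lt_uc/ltnW.
  rewrite perm_sort; apply: uniq_perm; first exact: undup_uniq.
    by rewrite cats1 rcons_uniq mem_sort mem_undup c_u sort_uniq undup_uniq.
  by move=> a; rewrite cats1 mem_undup !mem_rcons !inE mem_sort mem_undup.
rewrite /standardize map_rcons sortE; congr rcons; last first.
  by rewrite index_cat mem_sort mem_undup (negbTE c_u) /= eqxx addn0 size_sort.
by apply/eq_in_map => a au; rewrite index_cat mem_sort mem_undup au.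
Qed.

(** Ranks compare as letters do. Hence whether the last letter exceeds all others can be read off
    the standardized word, and this property passes between order-isomorphic words. *)
Lemma all_ltn_index_last (u : seq nat) (c : nat) :
  all (fun a => a < (index c (sort leq (undup (rcons u c)))).+1)
      [seq (index a (sort leq (undup (rcons u c)))).+1 | a <- u]
  = all (fun a => a < c) u.
Proof.
rewrite all_map; apply: eq_in_all => a au /=.
by rewrite ltnS ltn_index_sort_undup // mem_rcons inE ?eqxx ?au ?orbT.
Qed.

(** This removes [r] from the occurrence condition: for [r] above all letters of [tau], an
    occurrence of tau-r is one of [tau] with a later letter above all of its letters. *)
Lemma order_iso_rcons_max (u v : seq nat) (c d : nat) :
  all (fun a => a < d) v ->
  order_iso (rcons u c) (rcons v d) = order_iso u v && all (fun a => a < c) u.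
Proof.
move=> lt_vd; apply/idP/idP => [/eqP iso | /andP[/eqP iso lt_uc]].
  have lt_uc : all (fun a => a < c) u.
    rewrite -all_ltn_index_last; move: lt_vd; rewrite -all_ltn_index_last.
    by move: iso; rewrite /standardize !map_rcons => /rcons_inj[-> ->].
  rewrite lt_uc andbT; move: iso.
  by rewrite !standardize_rcons_max // => /rcons_inj[/eqP].
rewrite /order_iso !standardize_rcons_max //.
by rewrite -(size_undup_standardize u) iso size_undup_standardize.
Qed.

(** * Occurrences of both patterns and the cut at the largest letter *)

Lemma size_factor (w : seq nat) (p m : nat) :
  p + m <= size w -> size (factor w p m) = m.
Proof. by move=> le_w; rewrite /factor size_takel // size_drop; lia. Qed.

Lemma contains_subwordP (tau w : seq nat) :
  reflect (exists2 p, p + size tau <= size w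
             & order_iso (factor w p (size tau)) tau)
          (contains_subword tau w).
Proof.
apply: (iffP existsP) => [[p /andP[]]|[p le_p iso]]; first by exists p.
have lt_p : p < (size w).+1 by lia.
by exists (Ordinal lt_p); rewrite /= le_p.
Qed.

Lemma contains_vincularP (tau : seq nat) (r : nat) (w : seq nat) :
  0 < size tau -> all (fun a => a < r) tau ->
  reflect (exists p q, [/\ p + size tau <= q, q < size w,
             order_iso (factor w p (size tau)) tau
             & all (fun a => a < nth 0 w q) (factor w p (size tau))])
          (contains_vincular tau r w).
Proof.
move=> tau_gt0 lt_tau.
apply: (iffP existsP) => [[p /existsP[q]]|[p [q [le_q lt_q iso lt_f]]]].
  rewrite order_iso_rcons_max // => /and3P[le_q iso lt_f].
  by exists p, q.
have lt_p : p < size w by lia.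
exists (Ordinal lt_p); apply/existsP; exists (Ordinal lt_q).
by rewrite order_iso_rcons_max //= le_q iso.
Qed.

Lemma contains_vincular_split (tau : seq nat) (r k : nat) (u v : seq nat) :
  0 < size tau -> all (fun a => a < r) tau ->
  all (fun a => a <= k) u -> all (fun a => a <= k.+1) v ->
  contains_vincular tau r (u ++ k.+1 :: v)
  = contains_subword tau u || contains_vincular tau r v.
Proof.
move=> tau_gt0 lt_tau le_u le_v; set m := size tau.
set w := u ++ k.+1 :: v.
have size_w : size w = (size u + size v).+1 by rewrite size_cat /= addnS.
have nth_u : nth 0 w (size u) = k.+1 by rewrite nth_cat ltnn subnn.
have le_nth i : nth 0 w i <= k.+1.
  have [lt_i | le_i] := ltnP i (size w); last by rewrite nth_default.
  move: (mem_nth 0 lt_i); rewrite mem_cat inE => /or3P[/(allP le_u)||/(allP le_v)] //.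
    exact: leqW.
  by move/eqP->.
have factor_u p : p + m <= size u -> factor w p m = factor u p m.
  move=> le_p; rewrite /factor drop_cat; case: ltnP => [lt_p|]; last by lia.
  by rewrite takel_cat // size_drop; lia.
have factor_v p : factor w (size u + p.+1) m = factor v p m.
  by rewrite /factor drop_cat ltnNge leq_addr /= addKn.
have nth_v q : nth 0 w (size u + q.+1) = nth 0 v q.
  by rewrite nth_cat ltnNge leq_addr /= addKn.
apply/(contains_vincularP _ _ w tau_gt0 lt_tau)/orP => [[p [q [le_q lt_q iso lt_f]]]|].
  have [le_p|lt_p] := leqP (p + m) (size u).
    by left; apply/contains_subwordP; exists p; rewrite -/m // -factor_u.
  (* The factor ends beyond [u]. If it starts after the cut letter, the whole occurrence shifts into
     [v]. *)
  have [le_pu|lt_up] := leqP p (size u); last first.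
    right; apply/(contains_vincularP _ _ v tau_gt0 lt_tau).
    have Ep : p = size u + (p - (size u).+1).+1 by lia.
    have Eq : q = size u + (q - (size u).+1).+1 by lia.
    exists (p - (size u).+1), (q - (size u).+1).
    move: iso lt_f; rewrite {1 2}Ep {1}Eq factor_v nth_v.
    by split => //; rewrite -/m; lia.
  (* Otherwise the factor covers position [size u], so it contains [k.+1], which no letter of [w]
     exceeds. *)
  have lt_m : size u - p < m by lia.
  have : nth 0 (factor w p m) (size u - p) \in factor w p m.
    by apply: mem_nth; rewrite size_factor //; lia.
  move/(allP lt_f); rewrite nth_take // nth_drop subnKC // nth_u.
  by rewrite ltnNge le_nth.
case=> [/contains_subwordP[p le_p iso]|/(contains_vincularP _ _ v tau_gt0 lt_tau)].
  exists p, (size u); rewrite factor_u // size_w nth_u; split=> //; first by lia.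
  by apply/allP => a /mem_take/mem_drop/(allP le_u).
move=> [p [q [le_q lt_q iso lt_f]]].
exists (size u + p.+1), (size u + q.+1).
by rewrite factor_v nth_v size_w; split=> //; lia.
Qed.

(** Pigeonhole: a factor matching [tau] has [s] distinct letters, all positive and below a later
    letter [c <= s], which leaves only [c.-1 < s] values. *)
Lemma contains_vincular_few_letters (tau : seq nat) (s : nat) (w : seq nat) :
  tau =i iota 1 s -> 0 < s -> all (fun a => 0 < a <= s) w ->
  contains_vincular tau s.+1 w = false.
Proof.
move=> tauE s_gt0 le_w.
have lt_tau : all (fun a => a < s.+1) tau.
  by apply/allP => a; rewrite tauE mem_iota; lia.
have tau_gt0 : 0 < size tau.
  by have: 1 \in tau by [rewrite tauE mem_iota; lia]; case: (tau).
apply/(contains_vincularP _ _ w tau_gt0 lt_tau) => -[p [q [_ lt_q /eqP iso lt_f]]].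
set f := factor _ _ _ in iso lt_f; set c := nth 0 w q in lt_f.
have /andP[c_gt0 le_c] : 0 < c <= s by apply: (allP le_w); apply: mem_nth.
have: size (undup f) <= size (iota 1 c.-1).
  apply: uniq_leq_size => [|a]; first exact: undup_uniq.
  rewrite mem_undup mem_iota => af.
  have /andP[a_gt0 _] := allP le_w _ (mem_drop (mem_take af)).
  by have := allP lt_f _ af; lia.
rewrite -size_undup_standardize iso size_undup_standardize.
have /perm_size -> : perm_eq (undup tau) (iota 1 s).
  by apply: uniq_perm; rewrite ?undup_uniq ?iota_uniq // => a; rewrite mem_undup tauE.
by rewrite !size_iota; lia.
Qed.

(** * Sums over words *)

(** Summing an arbitrary [F], rather than counting avoiders, lets an induction on [n] absorb a
    leading letter into [F]. *)
Definition sum_words (F : seq nat -> nat) (n k : nat) : nat :=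
  \sum_(w : n.-tuple 'I_k) F (word_of w).

Lemma num_avoidingE (contains : pred (seq nat)) (n k : nat) :
  num_avoiding contains n k = sum_words (fun w => ~~ contains w) n k.
Proof.
rewrite /num_avoiding -sum1_card big_mkcond; apply: eq_bigr => w _.
by rewrite inE; case: contains.
Qed.

Lemma eq_sum_words (F G : seq nat -> nat) (n k : nat) :
  (forall w, size w = n -> all (fun a => 0 < a <= k) w -> F w = G w) ->
  sum_words F n k = sum_words G n k.
Proof.
move=> eq_FG; apply: eq_bigr => w _; apply: eq_FG.
  by rewrite size_map size_tuple.
by apply/allP => _ /mapP[i _ ->] /=.
Qed.

Lemma sum_words_const (c n k : nat) : sum_words (fun=> c) n k = k ^ n * c.
Proof. by rewrite /sum_words sum_nat_const card_tuple card_ord. Qed.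

Lemma sum_words_mulr (F : seq nat -> nat) (c n k : nat) :
  sum_words (fun w => F w * c) n k = sum_words F n k * c.
Proof. by rewrite /sum_words big_distrl. Qed.

Lemma sum_words0 (F : seq nat -> nat) (k : nat) : sum_words F 0 k = F [::].
Proof.
rewrite /sum_words (big_pred1 [tuple]) // => w /=.
by rewrite (tuple0 w); apply/esym/eqP.
Qed.

Lemma sum_wordsS (F : seq nat -> nat) (n k : nat) :
  sum_words F n.+1 k = \sum_(a < k) sum_words (fun w => F (a.+1 :: w)) n k.
Proof.
rewrite /sum_words pair_big /=.
rewrite (reindex (fun aw : 'I_k * n.-tuple 'I_k => [tuple of aw.1 :: aw.2])) //=.
exists (fun w => (thead w, [tuple of behead w])) => [[a w] _|w _] /=.
  by congr pair; apply: val_inj.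
by rewrite [RHS]tuple_eta; apply: val_inj.
Qed.

(** The index [i] is the position of the first [k.+1]; words without this letter give the first
    term. In the induction, a leading [k.+1] gives the term [i = 0], and any other leading letter is
    absorbed into [F]. *)
Lemma sum_words_split (F : seq nat -> nat) (n k : nat) :
  sum_words F n k.+1 = sum_words F n k +
  \sum_(i < n) sum_words (fun u =>
    sum_words (fun v => F (u ++ k.+1 :: v)) (n - i.+1) k.+1) i k.
Proof.
elim: n F => [|n IHn] F; first by rewrite big_ord0 !sum_words0 addn0.
rewrite !sum_wordsS big_ord_recr /= big_ord_recl sum_words0 subn1 /=.
rewrite addnA addnAC; congr addn.
under eq_bigr do rewrite IHn.
rewrite big_split /=; congr addn; rewrite exchange_big.
by apply: eq_bigr => i _; rewrite sum_wordsS.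
Qed.

(** * Generating functions *)

Local Open Scope ring_scope.

Lemma coef_fpsD (R : zmodType) (f g : fps R) (n : nat) :
  fps_coef (f + g) n = fps_coef f n + fps_coef g n.
Proof. by []. Qed.

Lemma coef_fpsB (R : zmodType) (f g : fps R) (n : nat) :
  fps_coef (f - g) n = fps_coef f n - fps_coef g n.
Proof. by []. Qed.

Lemma coef_fpsMn (R : zmodType) (f : fps R) (m n : nat) :
  fps_coef (f *+ m) n = fps_coef f n *+ m.
Proof. by elim: m => [//|m IHm]; rewrite !mulrS coef_fpsD IHm. Qed.

Lemma coef_fpsX_mul (R : comNzRingType) (f : fps R) (n : nat) :
  fps_coef (fpsX * f) n.+1 = fps_coef f n.
Proof.
rewrite /= 2!big_ord_recl /= mul0r add0r mul1r subn1 big1 ?addr0 // => i _.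
by rewrite mul0r.
Qed.

Lemma coef_fpsX_mul0 (R : comNzRingType) (f : fps R) :
  fps_coef (fpsX * f) 0 = 0.
Proof. by rewrite /= big_ord1 mul0r. Qed.

(** The factor [fpsX] accounts for the cut letter, and the Cauchy product for the lengths of [u] and
    [v]. *)
Lemma W_vincular_rec (tau : seq nat) (r k : nat) :
  (0 < size tau)%N -> all (fun a => a < r)%N tau ->
  W (contains_vincular tau r) k.+1 =
  W (contains_vincular tau r) k +
  fpsX * (W (contains_subword tau) k * W (contains_vincular tau r) k.+1).
Proof.
move=> tau_gt0 lt_tau; apply: fpsP => n.
rewrite coef_fpsD [LHS]/= [X in _ = X + _]/= !num_avoidingE sum_words_split natrD.
congr (_ + _); case: n => [|n]; first by rewrite coef_fpsX_mul0 big_ord0.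
rewrite coef_fpsX_mul /= natr_sum; apply: eq_bigr => i _.
rewrite !num_avoidingE subSS -natrM -sum_words_mulr; congr (_%:R).
apply: eq_sum_words => u _ u_k.
rewrite mulnC -sum_words_mulr; apply: eq_sum_words => v _ v_k.
rewrite contains_vincular_split //.
- by rewrite negb_or mulnC mulnb.
- by apply: sub_all u_k => a /andP[].
- by apply: sub_all v_k => a /andP[].
Qed.

(** No word over [s] letters contains the pattern, so the series is geometric with coefficients
    [s ^ n]. *)
Lemma W_vincular_base (tau : seq nat) (s : nat) :
  tau =i iota 1 s -> (0 < s)%N ->
  W (contains_vincular tau s.+1) s * (1 - s%:R * fpsX) = 1.
Proof.
move=> tauE s_gt0.
have coefW n : fps_coef (W (contains_vincular tau s.+1) s) n = (s ^ n)%:R.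
  rewrite /= num_avoidingE -[(s ^ n)%N]muln1 -sum_words_const; congr (_%:R).
  by apply: eq_sum_words => w _ w_s; rewrite contains_vincular_few_letters.
set f := W _ _ in coefW *.
rewrite mulrBr mulr1 mulrCA [f * _]mulrC mulr_natl; apply: fpsP => n.
rewrite coef_fpsB coef_fpsMn coefW.
case: n => [|n]; first by rewrite coef_fpsX_mul0 mul0rn subr0.
by rewrite coef_fpsX_mul coefW -mulrnA expnSr subrr.
Qed.

Theorem theorem4p1 (tau : seq nat) (r k : nat)
    (tau_pattern : is_pattern tau)
    (tau_largest : largest_letter tau (r - 1))
    (le_k : (r - 1 <= k)%N) :
  W (contains_vincular tau r) k =
  1 / ((1 - (r - 1)%:R * fpsX) *
       \prod_(r - 1 <= j < k) (1 - fpsX * W (contains_subword tau) j)).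
Proof.
have [p tauE] := tau_pattern; have /andP[max_tau le_tau] := tau_largest.
(* The letters of [tau] are those of [iota 1 p], so [r - 1] is at least 1: the natural subtraction
   does not truncate, and [r = p.+1]. *)
move: (max_tau); rewrite tauE mem_iota => r_p.
have p_r : (p <= r - 1)%N by apply: (allP le_tau); rewrite tauE mem_iota; lia.
have def_p : (r - 1 = p)%N by lia.
have def_r : r = p.+1 by lia.
rewrite def_p in le_k *; rewrite def_r.
have p_gt0 : (0 < p)%N by lia.
have tau_gt0 : (0 < size tau)%N by case: (tau) max_tau.
have lt_tau : all (fun a => a < p.+1)%N tau by rewrite -def_p.
(* The product form shows that the denominator is invertible, so the final quotient is a genuine
   inverse. *)
have main : W (contains_vincular tau p.+1) k * ((1 - p%:R * fpsX) *
    \prod_(p <= j < k) (1 - fpsX * W (contains_subword tau) j)) = 1.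
  (* The induction effectively starts at [k = p], where the product over [j] is empty; [k = 0]
     contradicts [p_gt0]. *)
  elim: k le_k => [|k IHk]; first by lia.
  rewrite leq_eqVlt => /predU1P[<-|].
    by rewrite big_geq // mulr1 W_vincular_base.
  rewrite ltnS => le_pk.
  (* Moving the product term of [W_vincular_rec] to the left yields exactly the factor gained at
     [j = k]. *)
  have rec_k : W (contains_vincular tau p.+1) k.+1
      * (1 - fpsX * W (contains_subword tau) k)
      = W (contains_vincular tau p.+1) k.
    rewrite mulrBr mulr1 [_ * (fpsX * _)]mulrC -mulrA.
    by rewrite {1}W_vincular_rec // addrK.
  rewrite big_nat_recr //= (mulrA (1 - _)) mulrCA rec_k mulrC.
  exact: IHk.
by rewrite div1r; symmetry; apply: mulr1_eq; rewrite mulrC.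
Qed.
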